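(* Let $\mathcal{L}$ be a countable many-sorted first-order signature and $(\mathcal{K},\mu)$ a measured model class over $\mathcal{L}$. If $\mathcal{K}\neq\varnothing$ and $\mu$ is a probability measure, then $\mathcal{F}_\mu:=\{a\in\mathbb{B}_{\mathcal{K}}:\bar\mu(a)=1\}$ is a proper filter in $\mathbb{B}_{\mathcal{K}}$. If, in addition, $\bar\mu(a)\in\{0,1\}$ for every $a\in\mathbb{B}_{\mathcal{K}}$, then $\mathcal{F}_\mu$ is an ultrafilter.
   Context: For a class $\mathcal{K}$ of $\mathcal{L}$-structures and an $\mathcal{L}$-sentence $\varphi$, $[\![\varphi]\!]_{\mathcal{K}}:=\{\mathfrak{M}\in\mathcal{K}:\mathfrak{M}\models\varphi\}$. A measured model class is a pair $(\mathcal{K},\mu)$ where $\mu$ is a probability measure on a $\sigma$-algebra on $\mathcal{K}$ containing all sets $[\![\varphi]\!]_{\mathcal{K}}$. Write $\varphi\equiv_{\mathcal{K}}\psi$ iff $[\![\varphi]\!]_{\mathcal{K}}=[\![\psi]\!]_{\mathcal{K}}$; $\mathbb{B}_{\mathcal{K}}:=\operatorname{Sent}(\mathcal{L})/\equiv_{\mathcal{K}}$ is a Boolean algebra with operations induced by $\neg,\wedge,\vee$, and $\bar\mu([\varphi]):=\mu([\![\varphi]\!]_{\mathcal{K}})$. *)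

(* Defs.v *)
From HB Require Import structures.
From mathcomp Require Import all_boot all_order all_algebra.
From mathcomp Require Import all_classical all_reals all_analysis.

Set Implicit Arguments.
Unset Strict Implicit.
Unset Printing Implicit Defensive.

Import Order.TTheory.

Local Open Scope classical_set_scope.
Local Open Scope quotient_scope.

(* Constants are function symbols of arity 0. *)
Record signature := Signature {
  sort : Type;
  fun_symb : Type;
  fun_arity : fun_symb -> nat;
  fun_dom : forall f, 'I_(fun_arity f) -> sort;
  fun_cod : fun_symb -> sort;
  rel_symb : Type;
  rel_arity : rel_symb -> nat;
  rel_dom : forall r, 'I_(rel_arity r) -> sort
}.

Definition countable_signature (L : signature) : Prop :=
  [/\ countable [set: sort L], countable [set: fun_symb L]
    & countable [set: rel_symb L]].

Section Syntax.
Variable L : signature.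
Implicit Types (G : seq (sort L)) (s : sort L).

(* Syntax is well-scoped and well-sorted: the index [G] lists the sorts of the
   free variables (de Bruijn), so a sentence is a formula over the empty list. *)
Inductive var : seq (sort L) -> sort L -> Type :=
| VarO G s : var (s :: G) s
| VarS G s t of var G s : var (t :: G) s.

Inductive fo_term G : sort L -> Type :=
| Var s of var G s : fo_term G s
| App (f : fun_symb L) of (forall i, fo_term G (@fun_dom L f i)) :
    fo_term G (fun_cod f).

Inductive formula : seq (sort L) -> Type :=
| FBot G : formula G
| FEq G s of fo_term G s & fo_term G s : formula G
| FRel G (r : rel_symb L) of (forall i, fo_term G (@rel_dom L r i)) : formula G
| FNot G of formula G : formula G
| FAnd G of formula G & formula G : formula G
| FOr G of formula G & formula G : formula G
| FEx G s of formula (s :: G) : formula G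
| FAll G s of formula (s :: G) : formula G.

Definition sentence : Type := formula [::].

End Syntax.

HB.instance Definition _ (L : signature) := gen_eqMixin (sentence L).
HB.instance Definition _ (L : signature) := gen_choiceMixin (sentence L).

(* Carriers are allowed to be empty; a class of structures with nonempty
   carriers is a particular [set (structure L)]. *)
Record structure (L : signature) := Structure {
  carrier : sort L -> Type;
  fun_interp : forall f : fun_symb L,
    (forall i, carrier (fun_dom (f := f) i)) -> carrier (fun_cod f);
  rel_interp : forall r : rel_symb L,
    (forall i, carrier (rel_dom (r := r) i)) -> Prop
}.

HB.instance Definition _ (L : signature) := gen_eqMixin (structure L).
HB.instance Definition _ (L : signature) := gen_choiceMixin (structure L).

Section Semantics.
Variables (L : signature) (M : structure L).

Fixpoint env (G : seq (sort L)) : Type :=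
  if G is s :: G' then (carrier M s * env G')%type else unit.

Fixpoint lookup G s (x : var G s) : env G -> carrier M s :=
  match x with
  | VarO _ _ => fun e => e.1
  | VarS _ _ _ y => fun e => lookup y e.2
  end.

Fixpoint eval G s (e : env G) (t : fo_term G s) : carrier M s :=
  match t with
  | Var _ x => lookup x e
  | App f a => fun_interp (fun i => eval e (a i))
  end.

Fixpoint holds G (p : formula G) : env G -> Prop :=
  match p with
  | FBot _ => fun=> False
  | FEq _ _ t u => fun e => eval e t = eval e u
  | FRel _ r a => fun e => rel_interp (fun i => eval e (a i))
  | FNot _ q => fun e => ~ holds q e
  | FAnd _ q r => fun e => holds q e /\ holds r e
  | FOr _ q r => fun e => holds q e \/ holds r e
  | FEx _ s q => fun e => exists a : carrier M s, holds q (a, e)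
  | FAll _ s q => fun e => forall a : carrier M s, holds q (a, e)
  end.

Definition satisfies (p : sentence L) : Prop := holds p tt.

End Semantics.

Section Lindenbaum.
Variables (L : signature) (K : set (structure L)).
Implicit Types p q r : sentence L.

Definition models p : set K := [set M : K | satisfies (val M) p].

Definition class_equiv p q : bool := `[< models p = models q >].

Lemma class_equiv_refl : reflexive class_equiv.
Proof. by move=> p; apply/asboolP. Qed.

Lemma class_equiv_sym : symmetric class_equiv.
Proof. by move=> p q; apply/asboolP/asboolP => ->. Qed.

Lemma class_equiv_trans : transitive class_equiv.
Proof. by move=> q p r /asboolP pq /asboolP qr; apply/asboolP; rewrite pq. Qed.

Canonical class_equiv_rel :=
  EquivRel class_equiv class_equiv_refl class_equiv_sym class_equiv_trans.

Definition lindenbaum := {eq_quot class_equiv}.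

HB.instance Definition _ := Choice.on lindenbaum.
HB.instance Definition _ := EqQuotient.on lindenbaum.

Implicit Types a b c : lindenbaum.

Definition sent_class p : lindenbaum := \pi_lindenbaum p.

Lemma sent_classP p q : sent_class p = sent_class q <-> models p = models q.
Proof.
split=> [/eqmodP/asboolP //|pq].
by apply/eqmodP/asboolP.
Qed.

Definition lmodels a : set K := models (repr a).

Lemma lmodels_class p : lmodels (sent_class p) = models p.
Proof. by apply/sent_classP; exact: reprK. Qed.

Lemma lmodels_inj : injective lmodels.
Proof. by move=> a b ab; rewrite -[a]reprK -[b]reprK; apply/sent_classP. Qed.

Definition lmeet a b := sent_class (FAnd (repr a) (repr b)).
Definition ljoin a b := sent_class (FOr (repr a) (repr b)).
Definition lcompl a := sent_class (FNot (repr a)).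
Definition lbot := sent_class (FBot [::]).
Definition ltop := sent_class (FNot (FBot [::])).

Lemma lmodelsI a b : lmodels (lmeet a b) = lmodels a `&` lmodels b.
Proof. by rewrite lmodels_class. Qed.

Lemma lmodelsU a b : lmodels (ljoin a b) = lmodels a `|` lmodels b.
Proof. by rewrite lmodels_class. Qed.

Lemma lmodelsC a : lmodels (lcompl a) = ~` lmodels a.
Proof. by rewrite lmodels_class. Qed.

Lemma lmodels0 : lmodels lbot = set0.
Proof. by rewrite lmodels_class. Qed.

Lemma lmodelsT : lmodels ltop = setT.
Proof. by rewrite lmodels_class; apply/seteqP; split=> // M _ []. Qed.

Let lmodelsE := (lmodelsI, lmodelsU, lmodelsC, lmodels0, lmodelsT).

Fact lmeetC : commutative lmeet.
Proof. by move=> a b; apply: lmodels_inj; rewrite !lmodelsE setIC. Qed.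
Fact ljoinC : commutative ljoin.
Proof. by move=> a b; apply: lmodels_inj; rewrite !lmodelsE setUC. Qed.
Fact lmeetA : associative lmeet.
Proof. by move=> a b c; apply: lmodels_inj; rewrite !lmodelsE setIA. Qed.
Fact ljoinA : associative ljoin.
Proof. by move=> a b c; apply: lmodels_inj; rewrite !lmodelsE setUA. Qed.
Fact ljoinKI b a : lmeet a (ljoin a b) = a.
Proof. by apply: lmodels_inj; rewrite !lmodelsE setUC setKU. Qed.
Fact lmeetKU b a : ljoin a (lmeet a b) = a.
Proof. by apply: lmodels_inj; rewrite !lmodelsE setIC setKI. Qed.
Fact lmeetUl : left_distributive lmeet ljoin.
Proof. by move=> a b c; apply: lmodels_inj; rewrite !lmodelsE setIUl. Qed.
Fact lmeetxx : idempotent_op lmeet.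
Proof. by move=> a; apply: lmodels_inj; rewrite !lmodelsE setIid. Qed.

HB.instance Definition _ :=
  Order.isMeetJoinDistrLattice.Build (Order.Disp tt tt) lindenbaum
    (fun _ _ => erefl) (fun _ _ => erefl)
    lmeetC ljoinC lmeetA ljoinA ljoinKI lmeetKU lmeetUl lmeetxx.

Fact lle0x a : (lbot <= a)%O.
Proof.
by apply/eqP/lmodels_inj; rewrite [LHS]lmodelsI lmodels0 set0I.
Qed.

Fact llex1 a : (a <= ltop)%O.
Proof. by apply/eqP/lmodels_inj; rewrite [LHS]lmodelsI lmodelsT setIT. Qed.

HB.instance Definition _ :=
  Order.hasBottom.Build (Order.Disp tt tt) lindenbaum lle0x.
HB.instance Definition _ :=
  Order.hasTop.Build (Order.Disp tt tt) lindenbaum llex1.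

Fact ljoinxC a : (a `|` lcompl a)%O = \top%O :> lindenbaum.
Proof.
by apply: lmodels_inj; rewrite [LHS]lmodelsU [RHS]lmodelsT lmodelsC setUv.
Qed.

Fact lmeetxC a : (a `&` lcompl a)%O = \bot%O :> lindenbaum.
Proof.
by apply: lmodels_inj; rewrite [LHS]lmodelsI [RHS]lmodels0 lmodelsC setICr.
Qed.

HB.instance Definition _ :=
  Order.TBDistrLattice_hasComplement.Build (Order.Disp tt tt) lindenbaum
    ljoinxC lmeetxC.

Lemma sent_class_not p : sent_class (FNot p) = (~` sent_class p)%O.
Proof.
by apply: lmodels_inj; rewrite [RHS]lmodelsC !lmodels_class.
Qed.

Lemma sent_class_and p q :
  sent_class (FAnd p q) = (sent_class p `&` sent_class q)%O.
Proof.
by apply: lmodels_inj; rewrite [RHS]lmodelsI !lmodels_class.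
Qed.

Lemma sent_class_or p q :
  sent_class (FOr p q) = (sent_class p `|` sent_class q)%O.
Proof.
by apply: lmodels_inj; rewrite [RHS]lmodelsU !lmodels_class.
Qed.

Lemma sent_class_bot : sent_class (FBot [::]) = \bot%O.
Proof. by []. Qed.

Lemma sent_class_le p q :
  (sent_class p <= sent_class q)%O <-> models p `<=` models q.
Proof.
rewrite leEmeet.
split=> [/eqP|pq].
  by rewrite -sent_class_and => /sent_classP <- M [].
apply/eqP; rewrite -sent_class_and; apply/sent_classP.
exact: setIidl.
Qed.

End Lindenbaum.

Section Filters.
Context {d : Order.disp_t} {B : ctbDistrLatticeType d}.
Implicit Type F : set B.

Definition lattice_filter F : Prop :=
  [/\ F \top%O,
      forall a b, F a -> F b -> F (a `&` b)%O
    & forall a b, F a -> (a <= b)%O -> F b].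

Definition proper_filter F : Prop := lattice_filter F /\ F <> setT.

Definition ultrafilter F : Prop :=
  proper_filter F /\ forall G, proper_filter G -> F `<=` G -> G = F.

End Filters.

Section MeasuredModelClass.
Variables (R : realType) (L : signature) (K : set (structure L)).

(* The library's measurable spaces are pointed types, so the nonemptiness of K
   is what makes K, as a type, the carrier of a measurable space. *)
Definition class_space (K0 : K !=set0) : Type := K.

HB.instance Definition _ (K0 : K !=set0) := Choice.on (class_space K0).
HB.instance Definition _ (K0 : K !=set0) :=
  isPointed.Build (class_space K0) (SigSub (mem_set (projT2 (cid K0)))).

(* A measured model class is a pair of [K] and an element of [class_measure].
   As [events] is a sigma-algebra, the measurable sets of
   [g_sigma_algebraType events] are exactly the elements of [events], cf.
   [measurable_g_measurableTypeE]. *)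
Record class_measure (K0 : K !=set0) := ClassMeasure {
  events : set (set (class_space K0));
  events_sigma_algebra : sigma_algebra setT events;
  events_models : forall p : sentence L, events (models p);
  class_prob :> probability (g_sigma_algebraType events) R
}.

Variables (K0 : K !=set0) (mu : class_measure K0).

Definition mu_bar (a : lindenbaum K) : \bar R := mu (lmodels a).

Lemma mu_barE p : mu_bar (sent_class K p) = mu (models p).
Proof. by rewrite /mu_bar lmodels_class. Qed.

Definition filter_of_measure : set (lindenbaum K) :=
  [set a | mu_bar a = 1%E].

End MeasuredModelClass.

(* Main.v *)
(* Closure under meets is subadditivity applied to the complements, which have
   measure 0. When the measure takes only the values 0 and 1, the filter
   contains each element or its complement; a proper filter contains no
   complementary pair, so such a filter is maximal. *)

Require Import Defs.
From mathcomp Require Import all_boot all_order all_algebra.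
From mathcomp Require Import all_classical all_reals all_analysis.

Set Implicit Arguments.
Unset Strict Implicit.
Unset Printing Implicit Defensive.

Import Order.Theory.

Local Open Scope classical_set_scope.

(** The order comes from meets: [a <= b] makes [a] equal to its meet with [b], whose models are an
    intersection. *)
Lemma sub_lmodels (L : signature) (K : set (structure L)) (a b : lindenbaum K) :
  (a <= b)%O -> lmodels a `<=` lmodels b.
Proof. by move=> /meet_l <- M; rewrite lmodelsI => -[]. Qed.

(** A complementary pair has meet [\bot], and every element lies above [\bot]. *)
Lemma proper_filter_complN {d : Order.disp_t} {B : ctbDistrLatticeType d}
    (F : set B) (a : B) : proper_filter F -> F a -> ~ F (~` a)%O.
Proof.
move=> [[_ FI Fle] FnT] Fa FCa; apply: FnT; apply/seteqP; split=> // b _.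
by apply: (Fle \bot%O); [rewrite -(meetxC a); exact: FI | exact: le0x].
Qed.

Lemma ultrafilter_of_dichotomy {d : Order.disp_t} {B : ctbDistrLatticeType d}
    (F : set B) :
  proper_filter F -> (forall a, F a \/ F (~` a)%O) -> ultrafilter F.
Proof.
move=> Fproper Fdich; split=> // G Gproper FG; apply/seteqP; split=> // a Ga.
by have [//|/FG GCa] := Fdich a; case: (proper_filter_complN Gproper Ga).
Qed.

Section MuBar.
Variables (R : realType) (L : signature) (K : set (structure L)).
Variables (K0 : K !=set0) (mu : class_measure R K0).
Implicit Types a b : lindenbaum K.

Lemma measurable_lmodels a :
  measurable (lmodels a : set (g_sigma_algebraType (events mu))).
Proof. by apply: sub_sigma_algebra; exact: events_models. Qed.

Lemma mu_bar_ge0 a : (0 <= mu_bar mu a)%E.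
Proof. exact: measure_ge0. Qed.

Lemma mu_bar_le1 a : (mu_bar mu a <= 1)%E.
Proof. by apply: probability_le1; exact: measurable_lmodels. Qed.

Lemma mu_barT : mu_bar mu \top%O = 1%E.
(* The explicit pattern is matched up to conversion, since [\top] is [ltop] only after unfolding the
   lattice structure. *)
Proof. by rewrite /mu_bar [lmodels _]lmodelsT; exact: probability_setT. Qed.

Lemma mu_bar0 : mu_bar mu \bot%O = 0%E.
Proof. by rewrite /mu_bar [lmodels _]lmodels0; exact: measure0. Qed.

Lemma mu_barC a : mu_bar mu (~` a)%O = (1 - mu_bar mu a)%E.
Proof.
rewrite /mu_bar [lmodels (~` a)%O]lmodelsC.
by apply: probability_setC; exact: measurable_lmodels.
Qed.

Lemma le_mu_bar a b : (a <= b)%O -> (mu_bar mu a <= mu_bar mu b)%E.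
Proof.
move=> /sub_lmodels ab.
by apply: le_measure => //; rewrite inE; exact: measurable_lmodels.
Qed.

Lemma mu_barU_le a b : (mu_bar mu (a `|` b)%O <= mu_bar mu a + mu_bar mu b)%E.
Proof.
rewrite /mu_bar [lmodels (a `|` b)%O]lmodelsU.
by apply: measureU2; exact: measurable_lmodels.
Qed.

(** Trades full measure for a null complement, the form to which subadditivity applies. *)
Lemma mu_bar_eq1 a : mu_bar mu a = 1%E <-> mu_bar mu (~` a)%O = 0%E.
Proof.
split=> h; first by rewrite mu_barC h subee.
by rewrite -(complK a) mu_barC h sube0.
Qed.

Lemma filter_of_measure_proper : proper_filter (filter_of_measure mu).
Proof.
split; last first.
  move=> FT; have : filter_of_measure mu \bot%O by rewrite FT.
  by rewrite /filter_of_measure/= mu_bar0 => /eqP; rewrite eq_sym onee_eq0.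
split; first exact: mu_barT.
- move=> a b /mu_bar_eq1 a0 /mu_bar_eq1 b0; apply/mu_bar_eq1.
  (* By De Morgan the complement of the meet is a join of two null elements. *)
  apply/eqP; rewrite eq_le mu_bar_ge0 andbT complI.
  by apply: le_trans (mu_barU_le _ _) _; rewrite a0 b0 adde0.
- move=> a b a1 /le_mu_bar ab; apply/eqP.
  (* Only the lower bound remains; writing 1 as the measure of [a] turns it into monotonicity. *)
  by rewrite eq_le mu_bar_le1 -a1.
Qed.

End MuBar.

Theorem theorem2p22 (R : realType) (L : signature)
    (L_countable : countable_signature L)
    (K : set (structure L)) (K_neq0 : K !=set0) (mu : class_measure R K_neq0) :
  proper_filter (filter_of_measure mu) /\
  ((forall a : lindenbaum K, mu_bar mu a = 0%E \/ mu_bar mu a = 1%E) ->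
   ultrafilter (filter_of_measure mu)).
Proof.
have Fproper := filter_of_measure_proper mu; split=> // mu01.
apply: ultrafilter_of_dichotomy => // a.
have [a0|a1] := mu01 a; [right | by left].
(* The criterion is applied to the complement of [a], whose own complement is the null element
   [a]. *)
by apply/mu_bar_eq1; rewrite complK.
Qed.
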